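(* (Weak Completeness) For every $(n,k)\in\omega^2$ and every $\phi\in L(C)$: $\models_{(n,k)}\phi$ implies $\vdash_{(n,k)}\phi$.
   Context: $\omega=\{0,1,2,\dots\}$. Let $\mathcal V$ be a countable set of atomic formulas, and let $L(C)$ be the set of formulas freely generated from $\mathcal V$ by the connectives $C=\{\neg,\rightarrow\}$ ($\neg$ unary, $\rightarrow$ binary). Semantics. For $(n,k)\in\omega^2$, the matrix $M_{(n,k)}$ has the set of truth-values $A_{(n,k)}=\{F_0,\dots,F_n,T_0,\dots,T_k\}$ ($n+k+2$ distinct elements), the set of designated values $D_{(n,k)}=\{T_0,\dots,T_k\}$, and the operations: $\neg F_0=T_0$, $\neg T_0=F_0$, $\neg F_r=F_{r-1}$ for $1\le r\le n$, $\neg T_i=T_{i-1}$ for $1\le i\le k$; $A\rightarrow B=F_0$ if $A\in D_{(n,k)}$ and $B\notin D_{(n,k)}$, and $A\rightarrow B=T_0$ otherwise. An $M_{(n,k)}$-valuation is a homomorphism $v:L(C)\to A_{(n,k)}$. $\Gamma\models_{(n,k)}\phi$ means: for every $M_{(n,k)}$-valuation $v$, $v(\Gamma)\subseteq D_{(n,k)}$ implies $v(\phi)\in D_{(n,k)}$; $\models_{(n,k)}\phi$ means $\emptyset\models_{(n,k)}\phi$. Secondary connectives (abbreviations in $L(C)$): $\copyright\phi:=(\phi\rightarrow\phi)\rightarrow\phi$; $\sim\phi:=\neg(\copyright\phi)$; $\phi\vee\psi:=\,\sim\phi\rightarrow\psi$; $\phi\wedge\psi:=\,\sim(\phi\rightarrow\sim\psi)$;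 $\phi^{\ast}:=\neg\phi\vee\phi$; $\phi^{\circ}:=\neg(\neg\phi\wedge\phi)$; $\neg^q\phi$ is $\phi$ preceded by $q$ negations ($\neg^0\phi=\phi$). Axiomatics. $\vdash_{(n,k)}$ is the Hilbert-style consequence relation ($\Gamma\vdash_{(n,k)}\phi$ iff there is a finite formal proof of $\phi$ from hypotheses in $\Gamma$; $\vdash_{(n,k)}\phi$ means $\emptyset\vdash_{(n,k)}\phi$) whose only inference rule is Modus Ponens (from $\phi$ and $\phi\rightarrow\psi$ infer $\psi$) and whose axiom schemas are: $Ax_1$: $\phi\rightarrow(\psi\rightarrow\phi)$; $Ax_2$: $(\phi\rightarrow(\psi\rightarrow\theta))\rightarrow((\phi\rightarrow\psi)\rightarrow(\phi\rightarrow\theta))$; $Ax_3$: $(\phi\rightarrow\psi)^{\ast}$; $Ax_4$: $(\phi\rightarrow\psi)^{\circ}$; $Ax_5$: $(\neg^n\phi)^{\ast}$; $Ax_6$: $(\neg^k\phi)^{\circ}$; $Ax_7$: $\phi^{\ast}\rightarrow[\psi^{\circ}\rightarrow((\neg\phi\rightarrow\neg\psi)\rightarrow((\neg\phi\rightarrow\psi)\rightarrow\phi))]$; $Ax_8$: $\phi^{\ast}\rightarrow[\psi^{\circ}\rightarrow((\phi\rightarrow\neg\psi)\rightarrow((\phi\rightarrow\psi)\rightarrow\neg\phi))]$; $Ax_9$: $\phi^{\ast}\rightarrow(\neg\neg\phi\rightarrow\phi)$; $Ax_{10}$: $\phi^{\circ}\rightarrow(\phi\rightarrow\neg\neg\phi)$;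 $Ax_{11}$: $\phi^{\ast}\rightarrow(\neg\phi)^{\ast}$; $Ax_{12}$: $\phi^{\circ}\rightarrow(\neg\phi)^{\circ}$. *)

(* Defs.v *)
From mathcomp Require Import all_boot.
From Stdlib Require List.
Set Implicit Arguments.
Unset Strict Implicit.
Unset Printing Implicit Defensive.

Inductive formula (V : Type) : Type :=
  | Atom of V
  | Neg of formula V
  | Imp of formula V & formula V.

Declare Scope formula_scope.
Delimit Scope formula_scope with F.
Bind Scope formula_scope with formula.
Notation "p ==> q" := (Imp p q) : formula_scope.

Section SecondaryConnectives.
Variable V : Type.
Implicit Types p q : formula V.
Local Open Scope formula_scope.

Definition copyright p := (p ==> p) ==> p.
Definition sneg p := Neg (copyright p).
Definition disjf p q := sneg p ==> q.
Definition conjf p q := sneg (p ==> sneg q).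
Definition star p := disjf (Neg p) p.
Definition circ p := Neg (conjf (Neg p) p).
Definition iter_neg m p := iter m (@Neg V) p.

End SecondaryConnectives.

(* The carrier of M_(n,k): [F_] and [T_] index F_0, ..., F_n and T_0, ..., T_k *)
Inductive tvalue (n k : nat) : Type :=
  | F_ of 'I_n.+1
  | T_ of 'I_k.+1.
Arguments F_ {n k}.
Arguments T_ {n k}.

Section Semantics.
Variables n k : nat.

Definition designated (a : tvalue n k) : bool :=
  if a is T_ _ then true else false.

(* [inord r.-1] is used only when r is nonzero, and then has value r - 1 *)
Definition tneg (a : tvalue n k) : tvalue n k :=
  match a with
  | F_ r => if r == ord0 then T_ ord0 else F_ (inord r.-1)
  | T_ i => if i == ord0 then F_ ord0 else T_ (inord i.-1)
  end.

Definition timp (a b : tvalue n k) : tvalue n k :=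
  if designated a && ~~ designated b then F_ ord0 else T_ ord0.

Variable V : Type.

Definition valuation (v : formula V -> tvalue n k) : Prop :=
  (forall p, v (Neg p) = tneg (v p)) /\
  (forall p q, v (Imp p q) = timp (v p) (v q)).

Definition entails (Gamma : formula V -> Prop) (p : formula V) : Prop :=
  forall v : formula V -> tvalue n k, valuation v ->
    (forall q, Gamma q -> designated (v q)) -> designated (v p).

End Semantics.

Section Axiomatics.
Variables (n k : nat) (V : Type).
Local Open Scope formula_scope.

Inductive axiom : formula V -> Prop :=
  | Ax1 p q : axiom (p ==> (q ==> p))
  | Ax2 p q r : axiom ((p ==> (q ==> r)) ==> ((p ==> q) ==> (p ==> r)))
  | Ax3 p q : axiom (star (p ==> q))
  | Ax4 p q : axiom (circ (p ==> q))
  | Ax5 p : axiom (star (iter_neg n p))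
  | Ax6 p : axiom (circ (iter_neg k p))
  | Ax7 p q : axiom (star p ==>
      (circ q ==> ((Neg p ==> Neg q) ==> ((Neg p ==> q) ==> p))))
  | Ax8 p q : axiom (star p ==>
      (circ q ==> ((p ==> Neg q) ==> ((p ==> q) ==> Neg p))))
  | Ax9 p : axiom (star p ==> (Neg (Neg p) ==> p))
  | Ax10 p : axiom (circ p ==> (p ==> Neg (Neg p)))
  | Ax11 p : axiom (star p ==> star (Neg p))
  | Ax12 p : axiom (circ p ==> circ (Neg p)).

(* A formal proof is listed in reverse order, its last line at the head *)
Fixpoint formal_proof (Gamma : formula V -> Prop) (s : seq (formula V)) : Prop :=
  if s is p :: s' then
    [\/ axiom p, Gamma p | exists q, List.In q s' /\ List.In (q ==> p) s'] /\
    formal_proof Gamma s'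
  else True.

Definition derives (Gamma : formula V -> Prop) (p : formula V) : Prop :=
  exists s, formal_proof Gamma (p :: s).

End Axiomatics.

Definition no_hyp (V : Type) : formula V -> Prop := fun=> False.
Arguments no_hyp : clear implicits.

(* Main.v *)
Require Import Defs.
From mathcomp Require Import all_boot.
From mathcomp Require Import boolp.
From Stdlib Require List.
Set Implicit Arguments.
Unset Strict Implicit.
Unset Printing Implicit Defensive.

(** If [phi] is not derivable, a Lindenbaum construction yields a deductively
closed set [d] of formulas that omits [phi] and contains exactly one of
[x], [sneg x] for every [x]. Such a [d] commutes with the classical connectives
[==>] and [sneg], but [Neg x] is not determined by [x]. However, [Ax9]-[Ax10]
show that once [x] and [Neg x] disagree about membership in [d], membership
alternates along [x], [Neg x], [Neg (Neg x)], ...; [Ax5] and [Ax6] bound the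
place of the first disagreement by [n] and [k], and [Ax3]-[Ax4] put it at the
start for implications. Hence the membership pattern of the iterated
negations of any formula is that of a truth-value of M_(n,k), and
reading off these truth-values gives a valuation refuting [phi]. *)

(** * Derivability: deduction theorem, explosion, case distinction *)

Section Provability.
Variables (n k : nat) (V : Type).
Local Open Scope formula_scope.
Implicit Types (p q r x y : formula V) (G : formula V -> Prop).

(** Tree-shaped derivations, on which induction is direct; [prov_derives] flattens them into
    lists. *)
Inductive prov G : formula V -> Prop :=
  | PAx p of axiom n k p : prov G p
  | PHyp p of G p : prov G p
  | PMp p q of prov G p & prov G (p ==> q) : prov G q.

Lemma In_cat (T : Type) (a : T) s t :
  List.In a s \/ List.In a t -> List.In a (s ++ t).
Proof.
elim: s => [|b s IHs] /=; first by case.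
by case=> [[->|H]|H]; [left|right; apply: IHs; left|right; apply: IHs; right].
Qed.

Lemma formal_proof_cat G s t :
  formal_proof n k G s -> formal_proof n k G t -> formal_proof n k G (s ++ t).
Proof.
move=> + Gt; elim: s => //= p s IHs [Hp /IHs Gs]; split=> //.
case: Hp => [axp|Gp|[q [qs qps]]]; [exact: Or31|exact: Or32|apply: Or33].
by exists q; split; apply: In_cat; left.
Qed.

Lemma prov_derives G p : prov G p -> derives n k G p.
Proof.
elim=> {p} [p axp|p Gp|p q _ [s ps] _ [t pqt]].
- by exists [::]; split; first exact: Or31.
- by exists [::]; split; first exact: Or32.
- exists ((p :: s) ++ (p ==> q) :: t); split; last exact: formal_proof_cat.
  apply: Or33; exists p; split; first by left.
  by apply: In_cat; right; left.
Qed.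

Definition extend G x : formula V -> Prop := fun y => G y \/ y = x.

Lemma prov_sub G1 G2 : (forall p, G1 p -> G2 p) ->
  forall p, prov G1 p -> prov G2 p.
Proof.
move=> sG p; elim=> {p} [p axp|p Gp|p q _ Gp _ Gpq].
- exact: PAx.
- exact/PHyp/sG.
- exact: PMp Gp Gpq.
Qed.

Lemma prov_extend G x p : prov G p -> prov (extend G x) p.
Proof. by apply: prov_sub => q; left. Qed.

Lemma prov_last G x : prov (extend G x) x.
Proof. by apply: PHyp; right. Qed.

Lemma prov_weaken G x p : prov G p -> prov G (x ==> p).
Proof. by move=> Gp; apply: PMp Gp (PAx _ (Ax1 _ _ _ _)). Qed.

Lemma prov_id G x : prov G (x ==> x).
Proof.
have H1 := PAx G (Ax1 n k x x).
have H2 := PAx G (Ax1 n k x (x ==> x)).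
exact: PMp H1 (PMp H2 (PAx _ (Ax2 _ _ _ _ _))).
Qed.

Lemma deduction G x p : prov (extend G x) p -> prov G (x ==> p).
Proof.
elim=> {p} [p axp|p [Gp|->]|p q _ Gp _ Gpq].
- exact/prov_weaken/PAx.
- exact/prov_weaken/PHyp.
- exact: prov_id.
- exact: PMp Gp (PMp Gpq (PAx _ (Ax2 _ _ _ _ _))).
Qed.

Lemma prov_copyright G x : prov G x -> prov G (copyright x).
Proof. exact: prov_weaken. Qed.

Lemma prov_copyrightE G x : prov G (copyright x) -> prov G x.
Proof. exact/PMp/prov_id. Qed.

Lemma prov_explosion G x y : prov G x -> prov G (sneg x) -> prov G y.
Proof.
move=> Gx GNx; apply: prov_copyrightE.
have A := PAx G (Ax7 n k (copyright y) (copyright x)).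
have {}A := PMp (PAx G (Ax3 n k _ _)) A.
have {}A := PMp (PAx G (Ax4 n k _ _)) A.
have {}A := PMp (prov_weaken _ GNx) A.
exact: PMp (prov_weaken _ (prov_copyright Gx)) A.
Qed.

Lemma prov_case G x y :
  prov (extend G x) y -> prov (extend G (sneg x)) y -> prov G y.
Proof.
move=> Gxy GNxy; apply: prov_copyrightE.
have A := PAx G (Ax7 n k (copyright y) (copyright y)).
have {}A := PMp (PAx G (Ax3 n k _ _)) A.
have {}A := PMp (PAx G (Ax4 n k _ _)) A.
have {}A := PMp (prov_id _ _) A.
apply: PMp A; apply: deduction; set G' := extend _ _.
apply: prov_copyright.
suff GN : prov G' (sneg x).
  by apply: PMp GN _; apply/prov_extend/deduction.
have B := PAx G' (Ax8 n k (copyright x) (copyright y)).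
have {}B := PMp (PAx G' (Ax3 n k _ _)) B.
have {}B := PMp (PAx G' (Ax4 n k _ _)) B.
have {}B := PMp (prov_weaken _ (prov_last G _)) B.
apply: PMp B; apply: deduction; apply: prov_copyright.
apply: PMp (prov_copyrightE (prov_last _ _)) _.
by do 2 apply: prov_extend; apply: deduction.
Qed.

End Provability.

(** * Countability of the formulas, via tree codes *)

Section FormulaEncoding.
Variable V : Type.

Fixpoint encode (p : formula V) : GenTree.tree V :=
  match p with
  | Atom x => GenTree.Leaf x
  | Neg p => GenTree.Node 0 [:: encode p]
  | Imp p q => GenTree.Node 1 [:: encode p; encode q]
  end.

Fixpoint decode (t : GenTree.tree V) : option (formula V) :=
  match t with
  | GenTree.Leaf x => Some (Atom x)
  | GenTree.Node _ [:: t] => omap (@Neg V) (decode t)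
  | GenTree.Node _ [:: t; u] =>
      if decode t is Some p then omap (Imp p) (decode u) else None
  | _ => None
  end.

Lemma encodeK : pcancel encode decode.
Proof. by elim=> //= [p ->|p -> q ->]. Qed.

End FormulaEncoding.

(** * Lindenbaum extension avoiding [phi] *)

Section Lindenbaum.
Variables (n k : nat) (V : countType) (phi : formula V).
Local Notation prov := (@prov n k V).

(** [sneg x] is added exactly when adding [x] would yield [phi]; by [prov_case], an unprovable [phi]
    then stays unprovable. *)
Definition decide (G : formula V -> Prop) (x : formula V) :=
  if `[< prov (extend G x) phi >] then extend G (sneg x) else extend G x.

Fixpoint stage (s : nat) : formula V -> Prop :=
  if s is s'.+1 then
    if obind (@decode V) (unpickle s') is Some x then decide (stage s') x
    else stage s'
  else no_hyp V.

Lemma decide_extends G x p : prov G p -> prov (decide G x) p.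
Proof. by rewrite /decide; case: asboolP => _; apply: prov_extend. Qed.

Lemma decide_consistent G x : ~ prov G phi -> ~ prov (decide G x) phi.
Proof.
move=> Gphi; rewrite /decide; case: asboolP => // Gxphi GNxphi.
exact/Gphi/(prov_case Gxphi GNxphi).
Qed.

Lemma decideP G x : prov (decide G x) x \/ prov (decide G x) (sneg x).
Proof.
by rewrite /decide; case: asboolP => _; [right|left]; apply: prov_last.
Qed.

Lemma stage_mono s t p : s <= t -> prov (stage s) p -> prov (stage t) p.
Proof.
move=> le_st Gp; rewrite -(subnK le_st); elim: (t - s) => //= m IHm.
by case: obind => // x; apply: decide_extends.
Qed.

Lemma stage_complete x : exists s, prov (stage s) x \/ prov (stage s) (sneg x).
Proof.
(* The formula with code c is decided in passing from stage c to stage c+1. *)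
exists (pickle (encode x)).+1; rewrite /= pickleK /= encodeK; exact: decideP.
Qed.

Hypothesis unprovable : ~ prov (no_hyp V) phi.

Lemma stage_consistent s : ~ prov (stage s) phi.
Proof.
by elim: s => //= s IHs; case: obind => // x; apply: decide_consistent.
Qed.

Lemma lindenbaum : exists d : pred (formula V),
  [/\ forall x, prov (no_hyp V) x -> d x,
      forall x y, d x -> d (Imp x y) -> d y,
      forall x, d (sneg x) = ~~ d x
    & ~~ d phi].
Proof.
(* The consequences of all stages are collected; what two stages prove is proved by the later
   one. *)
exists (fun x => `[< exists s, prov (stage s) x >]); split.
- by move=> x Hx; apply/asboolP; exists 0.
- move=> x y /asboolP[s Gx] /asboolP[t Gxy]; apply/asboolP; exists (maxn s t).
  apply: PMp (stage_mono (leq_maxl _ _) Gx) _.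
  exact: stage_mono (leq_maxr _ _) Gxy.
- move=> x; case: asboolP => [[s GNx]|GNx]; case: asboolP => [[t Gx]|Gx] //.
    case: (@stage_consistent (maxn s t)).
    apply: (prov_explosion (x := x)).
      exact: stage_mono (leq_maxr _ _) Gx.
    exact: stage_mono (leq_maxl _ _) GNx.
  by have [s [H|H]] := stage_complete x; [case: Gx|case: GNx]; exists s.
- by apply/asboolPn => -[s]; apply: stage_consistent.
Qed.

End Lindenbaum.

(** * Canonical valuation read off membership in [d] *)

Section CanonicalValuation.
Variables (n k : nat) (V : Type) (d : pred (formula V)) (phi : formula V).
Hypothesis d_prov : forall x, prov n k (no_hyp V) x -> d x.
Hypothesis d_mp : forall x y, d x -> d (Imp x y) -> d y.
Hypothesis d_sneg : forall x, d (sneg x) = ~~ d x.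
Hypothesis d_phi : ~~ d phi.
Local Open Scope formula_scope.
Implicit Types (x y z : formula V) (a : tvalue n k).

Lemma d_ax x : axiom n k x -> d x.
Proof. by move=> axx; apply/d_prov/PAx. Qed.

Lemma d_imp x y : d (x ==> y) = (d x ==> d y)%B.
Proof.
apply/idP/idP => [dxy|]; first by apply/implyP => dx; apply: d_mp dx dxy.
have [dx /= dy|dx _] := boolP (d x); first exact/(d_mp dy)/d_ax/Ax1.
have /d_mp: d (sneg x) by rewrite d_sneg.
apply; apply: d_prov; do 2 apply: deduction.
exact: prov_explosion (prov_last _ _ _ _) (prov_extend _ (prov_last _ _ _ _)).
Qed.

Lemma d_star x : d (star x) = d (Neg x) || d x.
Proof. by rewrite d_imp d_sneg; case: (d (Neg x)). Qed.

Lemma d_conj x y : d (conjf x y) = d x && d y.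
Proof. by rewrite d_sneg d_imp d_sneg; case: (d x) => //=; rewrite negbK. Qed.

Lemma d_circ_noglut x : d (circ x) -> ~~ (d (Neg x) && d x).
Proof.
move=> cx; apply/negP => /andP[dNx dx].
have sp := d_ax (Ax3 n k (phi ==> phi) phi).
have := d_ax (Ax7 n k (copyright phi) x).
rewrite d_imp sp d_imp cx !d_imp dNx dx !implybT /= implybb /=.
by rewrite (negPf d_phi).
Qed.

Lemma d_neg_boring y : d (star y) -> d (circ y) -> d (Neg y) = ~~ d y.
Proof. by rewrite d_star => + /d_circ_noglut; do 2 case: (d _). Qed.

Lemma d_neg_imp x y : d (Neg (x ==> y)) = ~~ d (x ==> y).
Proof. by apply: d_neg_boring; apply: d_ax; [apply: Ax3|apply: Ax4]. Qed.

(** [conjf] unfolds to the negation of an implication, so [Ax11] and [Ax12] carry over to it what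
    [Ax3] and [Ax4] say of implications. *)
Lemma d_circ x : d (circ x) = ~~ (d (Neg x) && d x).
Proof.
rewrite -d_conj; apply: d_neg_boring.
  apply: d_mp (d_ax (Ax11 _ _ _)); exact/d_ax/Ax3.
apply: d_mp (d_ax (Ax12 _ _ _)); exact/d_ax/Ax4.
Qed.

Lemma d_negneg x : d (Neg x) = ~~ d x -> d (Neg (Neg x)) = d x.
Proof.
move=> E; apply/idP/idP => H.
  have := d_ax (Ax9 n k x).
  by rewrite d_imp d_star E orNb d_imp H.
have := d_ax (Ax10 n k x).
by rewrite !d_imp d_circ E H.
Qed.

(** Agreement at every [j], not only at 0, lets the relation pass from [x] to [Neg x]. *)
Definition represents a x :=
  forall j, d (iter_neg j x) = designated (iter j (@tneg n k) a).

Lemma represents_neg a x : represents a x -> represents (tneg a) (Neg x).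
Proof.
by move=> H j; have := H j.+1; rewrite /iter_neg !iterSr.
Qed.

Lemma represents_step a x :
  d x = designated a -> represents (tneg a) (Neg x) -> represents a x.
Proof.
by move=> dx H [|j] //; have := H j; rewrite /iter_neg -!iterSr.
Qed.

(** Negation exchanges [T_ ord0] and [F_ ord0], and [d_negneg] propagates the disagreement to all
    iterated negations. *)
Lemma represents_alternating x : d (Neg x) = ~~ d x ->
  represents (if d x then T_ ord0 else F_ ord0) x.
Proof.
move=> E j; elim: j x E => [|j IHj] x E; first by rewrite /=; case: (d x).
have := IHj (Neg x); rewrite d_negneg // E negbK => /(_ erefl).
rewrite /iter_neg !iterSr => ->; congr (designated (iter _ _ _)).
by case: (d x).
Qed.

Lemma tneg_T (i : 'I_k.+1) : 0 < i -> @tneg n k (T_ i) = T_ (inord i.-1).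
Proof. by rewrite /= -val_eqE /=; case: (val i). Qed.

Lemma tneg_F (r : 'I_n.+1) : 0 < r -> @tneg n k (F_ r) = F_ (inord r.-1).
Proof. by rewrite /= -val_eqE /=; case: (val r). Qed.

(** The index counts the negations made before alternation sets in: each one lowers it by 1, down to
    0. *)
Lemma represents_T i x : i <= k -> (forall j, j <= i -> d (iter_neg j x)) ->
  ~~ d (iter_neg i.+1 x) -> represents (T_ (inord i)) x.
Proof.
elim: i x => [|i IHi] x le_ik dx dNx.
  have d0 := dx 0 isT; have := @represents_alternating x.
  rewrite d0 (negPf dNx) => /(_ erefl).
  by congr (represents (T_ _) _); apply/val_inj; rewrite /= inordK.
apply: represents_step; first exact: dx 0 isT.
rewrite tneg_T inordK //; apply: IHi => [|j le_ji|]; first exact: ltnW.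
  by have := dx j.+1 le_ji; rewrite /iter_neg iterSr.
by move: dNx; rewrite /iter_neg iterSr.
Qed.

Lemma represents_F i x : i <= n -> (forall j, j <= i -> ~~ d (iter_neg j x)) ->
  d (iter_neg i.+1 x) -> represents (F_ (inord i)) x.
Proof.
elim: i x => [|i IHi] x le_in dx dNx.
  have d0 : d x = false by exact: negPf (dx 0 isT).
  have := @represents_alternating x.
  rewrite d0 [d (Neg x)]dNx => /(_ erefl).
  by congr (represents (F_ _) _); apply/val_inj; rewrite /= inordK.
apply: represents_step; first exact: negPf (dx 0 isT).
rewrite tneg_F inordK //; apply: IHi => [|j le_ji|]; first exact: ltnW.
  by have := dx j.+1 le_ji; rewrite /iter_neg iterSr.
by move: dNx; rewrite /iter_neg iterSr.
Qed.

Lemma first_flip (b : pred nat) m : (exists2 j, j <= m.+1 & b j) -> ~~ b 0 ->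
  exists2 i, i <= m & b i.+1 /\ forall j, j <= i -> ~~ b j.
Proof.
case=> j0 le_j0 bj0 b0; have ex : exists j, b j by exists j0.
case: (ex_minnP ex) => [[|i]] bi min_i; first by rewrite bi in b0.
exists i; first exact: leq_trans (min_i _ bj0) le_j0.
by split=> // j le_ji; apply/negP => /min_i; rewrite ltnNge le_ji.
Qed.

Lemma representable x : exists a, represents a x.
Proof.
case dx: (d x).
  have := @first_flip (fun j => ~~ d (iter_neg j x)) k; case=> [||i le_ik [dN dj]].
  (* The k-th and (k+1)-st negations are not both in [d], so the first one outside has position i+1
     with i at most k. *)
  - have := d_ax (Ax6 n k x); rewrite d_circ negb_and => /orP[] H.
      by exists k.+1.
    by exists k.
  - by rewrite /= dx.
  - exists (T_ (inord i)); apply: represents_T => // j /dj; exact: negbNE.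
have := @first_flip (fun j => d (iter_neg j x)) n; case=> [||i le_in [dN dj]].
(* Dually, the n-th or the (n+1)-st negation is in [d]. *)
- have := d_ax (Ax5 n k x); rewrite d_star => /orP[] H.
    by exists n.+1.
  by exists n.
- by rewrite /= dx.
- by exists (F_ (inord i)); apply: represents_F.
Qed.

Lemma canonical_valuation : exists2 v : formula V -> tvalue n k,
  valuation v & forall x, designated (v x) = d x.
Proof.
have [val_atom atomP] := choice (fun x : V => representable (Atom x)).
(* Values are chosen for atoms only, so that [v] is a homomorphism by construction. *)
pose v := fix v x := match x with
  | Atom x => val_atom x
  | Neg x => tneg (v x)
  | Imp x y => timp (v x) (v y)
  end.
suff vP x : represents (v x) x by exists v => // x; rewrite [RHS](vP x 0).
elim: x => [x|x IHx|x IHx y IHy] /=; first exact: atomP.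
  exact: represents_neg.
(* Membership alternates from the start for implications, which matches the only values of [timp],
   [T_ ord0] and [F_ ord0]. *)
have := represents_alternating (d_neg_imp x y); congr represents.
rewrite /timp -[designated (v x)](IHx 0) -[designated (v y)](IHy 0) d_imp /=.
by do 2 case: (d _).
Qed.

End CanonicalValuation.

Theorem theorem4p5 (V : countType) (n k : nat) (phi : formula V) :
  entails n k (no_hyp V) phi -> derives n k (no_hyp V) phi.
Proof.
move=> valid; apply: prov_derives; apply: contrapT => unprovable.
have [d [d_prov d_mp d_sneg d_phi]] := lindenbaum unprovable.
have [v val_v vE] := canonical_valuation d_prov d_mp d_sneg d_phi.
by move: d_phi; rewrite -vE valid.
Qed.
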